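(* Let $M$ be a factor graph with factors $\phi_1,\ldots,\phi_m$, of which $\phi_1,\ldots,\phi_k$ with $0\le k\le m$ are $\varepsilon$-commutative with respect to $\boldsymbol C_{\phi_1},\ldots,\boldsymbol C_{\phi_k}$, respectively. For each $i\in\{1,\ldots,k\}$, let $\{\boldsymbol r_i^1,\ldots,\boldsymbol r_i^{l_i}\}$ be a set of representatives, one for each of the pairwise disjoint equivalence classes (symmetry sets) $[\boldsymbol r_i^1]_{\phi_i},\ldots,[\boldsymbol r_i^{l_i}]_{\phi_i}$ of $\phi_i$, whose union is $\mathcal X_{\boldsymbol R_{\phi_i}}$, ordered by size so that $m_{i,1}\ge\cdots\ge m_{i,l_i}\ge1$, where $m_{i,j}:=|[\boldsymbol r_i^j]_{\phi_i}|$. Let $M'$ be the factor graph obtained from $M$ by replacing each factor $\phi_i$, $1\le i\le k$, by its mean-based symmetrised representative factor $\phi_i^*$. Then, for the induced distributions $P_M$ and $P_{M'}$ and $\varepsilon>0$, it holds that $$D_{CD}(P_M,P_{M'})\le \ln\prod_{i=1}^k\frac{\left(1+\frac{m_{i,2}-1}{m_{i,2}}\varepsilon\right)(1+\varepsilon)}{1+\frac1{m_{i,1}}\varepsilon}<\ln\big((1+\varepsilon)^{2k}\big).$$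
   Context: Factors: a factor $\phi(R_1,\ldots,R_n)$ is a function $\phi:\mathcal X_{\boldsymbol R_\phi}\to\mathbb R_{\ge 0}$, where $\boldsymbol R_\phi=\{R_1,\ldots,R_n\}$ are (discrete) random variables and $\mathcal X_{\boldsymbol R_\phi}=\prod_{i}\mathrm{range}(R_i)$; each factor takes at least one positive value. Factor graph: a factor graph $M$ consists of a finite set $\boldsymbol R$ of random variables and factors $\phi_1,\ldots,\phi_m$ with argument sets $\boldsymbol R_{\phi_j}\subseteq\boldsymbol R$. For an assignment $\boldsymbol r\in\mathcal X_{\boldsymbol R}=\prod_{R\in\boldsymbol R}\mathrm{range}(R)$ let $\boldsymbol r_j$ be its projection to the arguments of $\phi_j$, $\psi(\boldsymbol r)=\prod_{j=1}^m\phi_j(\boldsymbol r_j)$, $Z=\sum_{\boldsymbol r}\psi(\boldsymbol r)$ and $P_M(\boldsymbol r)=\psi(\boldsymbol r)/Z$. $\varepsilon$-commutativity: let $\varepsilon\in[0,1]$. For $\boldsymbol C_\phi\subseteq\boldsymbol R_\phi$ with $|\boldsymbol C_\phi|\ge2$ (all members having the same range), let $\Pi_{\boldsymbol C_\phi}=\{\pi\in S_n\mid \pi(i)=i\text{ for all }R_i\notin\boldsymbol C_\phi\}$. The factor $\phi$ is $\varepsilon$-commutative with respect to $\boldsymbol C_\phi$ if for all assignments $(r_1,\ldots,r_n)$ and all $\pi\in\Pi_{\boldsymbol C_\phi}$, with $a=\phi(r_1,\ldots,r_n)$ and $b=\phi(r_{\pi(1)},\ldots,r_{\pi(n)})$,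 one has $a\in[b(1-\varepsilon),b(1+\varepsilon)]$ and $b\in[a(1-\varepsilon),a(1+\varepsilon)]$. Symmetry sets and mean: the symmetry set of $\boldsymbol r$ is $[\boldsymbol r]_\phi=\mathfrak S_\phi(\boldsymbol r)=\{(r_{\pi(1)},\ldots,r_{\pi(n)})\mid\pi\in\Pi_{\boldsymbol C_\phi}\}$; these sets partition $\mathcal X_{\boldsymbol R_\phi}$. The mean-based symmetrised representative factor of $\phi$ is $\phi^*(\boldsymbol r)=\frac1{|\mathfrak S_\phi(\boldsymbol r)|}\sum_{\boldsymbol r'\in\mathfrak S_\phi(\boldsymbol r)}\phi(\boldsymbol r')$. Distance: $D_{CD}(P_M,P_{M'})=\ln\max_{\boldsymbol r}\frac{P_{M'}(\boldsymbol r)}{P_M(\boldsymbol r)}-\ln\min_{\boldsymbol r}\frac{P_{M'}(\boldsymbol r)}{P_M(\boldsymbol r)}$, where the maximum and minimum are over assignments $\boldsymbol r$ for which the quotient is defined, i.e. $P_M(\boldsymbol r)>0$.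
   Formalization: The first inequality is stated only if, for each i ≤ k, m_{i,1}=1 or m_{i,2}≥2 (it fails for class sizes 2,1,1); the strict ones, including D_CD < ln((1+ε)^{2k}), are stated for k ≥ 1 (false at k=0). Z>0 is assumed, and m_{i,2}:=1 if l_i=1. *)

(* Defs.v *)
(* MathComp, with real logarithms from MathComp-Analysis. *)
From HB Require Import structures.
From mathcomp Require Import all_boot all_order all_algebra all_fingroup.
From mathcomp Require Import reals exp.

Set Implicit Arguments.
Unset Strict Implicit.
Unset Printing Implicit Defensive.

Import Order.TTheory GRing.Theory Num.Theory.
Local Open Scope ring_scope.

(* All ranges live in one finite type of values [D]; the random variables are
   the elements of [V], and [rng v] is the set of values that [v] can take.
   This makes "having the same range" a plain equality and lets a permutation
   of arguments act on assignments by precomposition. *)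

Section Factors.
Variables (R : realType) (V D : finType) (rng : V -> {set D}).

(* A factor is total on ['I_n -> D]; only its values at assignments that respect
   the ranges (see [fdom]) enter the definitions of factor graphs, of
   epsilon-commutativity and of the mean below. *)
Record factor := Factor {
  arity : nat;
  arg : 'I_arity -> V;
  pot :> {ffun 'I_arity -> D} -> R;
  arg_inj : injective arg;
  pot_ge0 : forall x, 0 <= pot x;
  pot_gt0 : exists2 x : {ffun 'I_arity -> D},
              (forall i, x i \in rng (arg i)) & 0 < pot x
}.

Implicit Types (phi : factor) (C : {set V}) (e : R).

Definition args phi : {set V} := [set arg i | i : 'I_(arity phi)].

Definition fdom phi : {set {ffun 'I_(arity phi) -> D}} :=
  [set x : {ffun 'I_(arity phi) -> D} | [forall i, x i \in rng (arg i)]].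

Definition permute n (x : {ffun 'I_n -> D}) (s : 'S_n) : {ffun 'I_n -> D} :=
  [ffun i => x (s i)].

Definition perms_on phi C : {set 'S_(arity phi)} :=
  [set s : 'S_(arity phi) | [forall i, (arg i \notin C) ==> (s i == i)]].

Definition eps_commutative e phi C : Prop :=
  [/\ C \subset args phi,
      (2 <= #|C|)%N,
      {in C &, forall v w, rng v = rng w} &
      {in fdom phi & perms_on phi C, forall x s,
        let a := phi x in
        let b := phi (permute x s) in
        b * (1 - e) <= a <= b * (1 + e) /\ a * (1 - e) <= b <= a * (1 + e)}].

Definition symset phi C (x : {ffun 'I_(arity phi) -> D}) :
    {set {ffun 'I_(arity phi) -> D}} :=
  [set permute x s | s in perms_on phi C].

Definition mean_pot phi C (x : {ffun 'I_(arity phi) -> D}) : R :=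
  (#|symset C x|%:R)^-1 * \sum_(y in symset C x) phi y.

Lemma symset_refl phi C x : x \in symset (phi := phi) C x.
Proof.
apply/imsetP; exists 1%g.
  by rewrite inE; apply/forallP => i; rewrite perm1 eqxx implybT.
by apply/ffunP => i; rewrite ffunE perm1.
Qed.

Lemma mean_pot_ge0 phi C x : 0 <= mean_pot (phi := phi) C x.
Proof.
by rewrite mulr_ge0 ?invr_ge0 ?ler0n // sumr_ge0 // => y _; apply: pot_ge0.
Qed.

Lemma mean_pot_gt0 phi C :
  exists2 x : {ffun 'I_(arity phi) -> D},
    (forall i, x i \in rng (arg i)) & 0 < mean_pot C x.
Proof.
have [x xD x_gt0] := pot_gt0 phi; exists x => //.
have xS := symset_refl C x.
rewrite mulr_gt0 ?invr_gt0 ?ltr0n ?card_gt0; first last.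
- rewrite (bigD1 x) //= ltr_pwDl // sumr_ge0 // => y _; exact: pot_ge0.
- by apply/set0Pn; exists x.
by [].
Qed.

Definition mean_factor C phi : factor :=
  Factor (@arg_inj phi) (@mean_pot_ge0 phi C) (mean_pot_gt0 phi C).

(* [xs] lists exactly one representative of each symmetry set, by decreasing
   size of the symmetry sets. *)
Definition ordered_representatives phi C
    (xs : seq {ffun 'I_(arity phi) -> D}) : Prop :=
  [/\ {subset xs <= fdom phi},
      pairwise (fun x y => [disjoint symset C x & symset C y]) xs,
      \bigcup_(x <- xs) symset C x = fdom phi &
      sorted geq [seq #|symset C x| | x <- xs]].

(* Size of the [j]-th largest symmetry set, counting from 1.  The default value
   1 matters only for [j = 2] when there is a single symmetry set; if
   [eps_commutative e phi C], that happens only if [fdom phi] is a singleton. *)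
Definition class_size phi C (xs : seq {ffun 'I_(arity phi) -> D}) (j : nat) :
    nat :=
  nth 1%N [seq #|symset C x| | x <- xs] j.-1.

Definition assignments : {set {ffun V -> D}} :=
  [set r : {ffun V -> D} | [forall v, r v \in rng v]].

Definition proj phi (r : {ffun V -> D}) : {ffun 'I_(arity phi) -> D} :=
  [ffun i => r (arg i)].

Section Graphs.
Variable m : nat.
Implicit Type M : 'I_m -> factor.

Definition psi M (r : {ffun V -> D}) : R := \prod_(j < m) M j (proj (M j) r).

Definition partition_function M : R := \sum_(r in assignments) psi M r.

Definition distr M (r : {ffun V -> D}) : R := psi M r / partition_function M.

Definition symmetrise (k : nat) (C : 'I_m -> {set V}) M : 'I_m -> factor :=
  fun i => if (i < k)%N then mean_factor (C i) (M i) else M i.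

End Graphs.

Section Distance.
Variables P P' : {ffun V -> D} -> R.

Definition max_quotient : R :=
  \big[Num.max/0]_(r in assignments | 0 < P r) (P' r / P r).

(* The neutral element is [max_quotient], which is an upper bound of all the
   quotients, hence does not affect the minimum. *)
Definition min_quotient : R :=
  \big[Num.min/max_quotient]_(r in assignments | 0 < P r) (P' r / P r).

Definition D_CD : R := ln max_quotient - ln min_quotient.

End Distance.

End Factors.

(* Main.v *)
Require Import Defs.
From HB Require Import structures.
From mathcomp Require Import all_boot all_order all_algebra all_fingroup.
From mathcomp Require Import reals exp.
From mathcomp Require Import ring lra.

Import Order.TTheory GRing.Theory Num.Theory.
Local Open Scope ring_scope.

(** A factor [phi] changes by at most [1 + eps] inside a symmetry set of size
    [n], so replacing it by its mean multiplies its values there by at most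
    [1 + (n - 1) / n * eps] and at least [(1 + eps / n) / (1 + eps)].  Partition
    functions cancel in D_CD, which is therefore bounded by the logarithm of
    the product over the factors of the worst ratio between two such multipliers.
    Two arguments in distinct symmetry sets have sizes at most [m_1] and [m_2]
    in some order, and the worse order is the one of the theorem; two arguments
    in the same symmetry set give at most [1 + eps], which is smaller as soon as
    [m_2 >= 2]. *)

(** [n] is the size of the class where the mean is bounded from above, [p] of the one where it is
    bounded from below. *)
Definition spread {R : realFieldType} (e : R) (n p : nat) : R :=
  (1 + (n%:R - 1) / n%:R * e) * (1 + e) / (1 + 1 / p%:R * e).

(** * Inequalities for the worst ratio of two multipliers *)

Section Spread.
Context {R : realFieldType} {e : R}.
Hypothesis e_gt0 : 0 < e.

(** With the reciprocals of the sizes as variables, the inequalities below become polynomial. *)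
Lemma spread_inv (n p : nat) : (0 < n)%N ->
  spread e n p = (1 + (1 - n%:R^-1) * e) * (1 + e) / (1 + p%:R^-1 * e).
Proof. by move=> n0; rewrite /spread mulrBl divff ?pnatr_eq0 -?lt0n // !mul1r. Qed.

Lemma invn_le1 {n : nat} : (0 < n)%N -> 0 < (n%:R^-1 : R) <= 1.
Proof. by move=> n0; rewrite invr_gt0 ltr0n n0 invf_le1 ?ler1n ?ltr0n. Qed.

Lemma spread_gt0 (n p : nat) : (0 < n)%N -> (0 < p)%N -> 0 < spread e n p.
Proof.
move=> n0 p0; rewrite spread_inv //.
have /andP[u0 u1] := invn_le1 n0; have /andP[v0 v1] := invn_le1 p0.
have n_ge0 : 0 <= (1 - n%:R^-1) * e by rewrite mulr_ge0 ?subr_ge0 // ltW.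
have p_gt0 : 0 < p%:R^-1 * e by rewrite mulr_gt0.
by rewrite divr_gt0 ?mulr_gt0 // ltr_pwDl // ltW.
Qed.

Lemma spread_lt (n p : nat) : (0 < n)%N -> (0 < p)%N ->
  spread e n p < (1 + e) ^+ 2.
Proof.
move=> n0 p0; rewrite spread_inv //.
have /andP[u0 u1] := invn_le1 n0; have /andP[v0 v1] := invn_le1 p0.
move: n%:R^-1 p%:R^-1 u0 u1 v0 v1 => u v u0 u1 v0 v1.
have ue : 0 < u * e by rewrite mulr_gt0.
have ve : 0 < v * e by rewrite mulr_gt0.
rewrite ltr_pdivrMr; last lra.
rewrite expr2 mulrAC ltr_pM2r; last by rewrite addr_gt0.
have eve : 0 < e * (v * e) by rewrite mulr_gt0.
by lra.
Qed.

(** A larger [n] raises the numerator, a larger [p] lowers the denominator. *)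
Lemma spread_mono (n n' p p' : nat) : (0 < n <= n')%N -> (0 < p <= p')%N ->
  spread e n p <= spread e n' p'.
Proof.
move=> /andP[n0 nn'] /andP[p0 pp'].
have n'0 := leq_trans n0 nn'; have p'0 := leq_trans p0 pp'.
rewrite !spread_inv //.
have uu : n'%:R^-1 <= n%:R^-1 :> R by rewrite lef_pV2 ?ler_nat ?posrE ?ltr0n.
have vv : p'%:R^-1 <= p%:R^-1 :> R by rewrite lef_pV2 ?ler_nat ?posrE ?ltr0n.
have /andP[u0 u1] := invn_le1 n0; have /andP[v0 _] := invn_le1 p'0.
move: n%:R^-1 p%:R^-1 n'%:R^-1 p'%:R^-1 uu vv u0 u1 v0 => u v u' v'.
move=> uu vv u0 u1 v0.
have ve : 0 < v' * e by rewrite mulr_gt0.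
have vve : v' * e <= v * e by rewrite ler_pM2r.
have uue : u' * e <= u * e by rewrite ler_pM2r.
have ue : u * e <= e by rewrite ler_piMl // ltW.
have e1 : 0 < 1 + e by rewrite addr_gt0.
have w0 : 0 < 1 + v' * e by lra.
have w0' : 0 < 1 + v * e by lra.
apply: ler_pM.
- by apply: mulr_ge0; nra.
- by rewrite invr_ge0 ltW.
- by rewrite ler_pM2r //; nra.
- by rewrite lef_pV2 ?posrE //; lra.
Qed.

(* With [u = 1 / n], clearing denominators leaves [u * (1 - u)] on either side,
   which is increasing for [u <= 1 / 2]. *)
Lemma spread_swap (n p : nat) : (2 <= n <= p)%N -> spread e p n <= spread e n p.
Proof.
move=> /andP[n2 np]; have n0 : (0 < n)%N by apply: leq_trans n2.
have p0 := leq_trans n0 np.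
rewrite !spread_inv //.
have uu : p%:R^-1 <= n%:R^-1 :> R by rewrite lef_pV2 ?ler_nat ?posrE ?ltr0n.
have u2 : n%:R^-1 <= 2^-1 :> R by rewrite lef_pV2 ?ler_nat ?posrE ?ltr0n.
have /andP[v0 _] := invn_le1 p0; have /andP[u0 _] := invn_le1 n0.
move: n%:R^-1 p%:R^-1 uu u2 u0 v0 => u v uu u2 u0 v0.
have ue : 0 < u * e by rewrite mulr_gt0.
have ve : 0 < v * e by rewrite mulr_gt0.
rewrite ler_pdivrMr; last lra.
rewrite mulrAC ler_pdivlMr; last lra.
rewrite mulrAC [leRHS]mulrAC ler_pM2r; last by rewrite addr_gt0.
rewrite -subr_ge0.
have -> : (1 + (1 - u) * e) * (1 + u * e) - (1 + (1 - v) * e) * (1 + v * e) =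
   e ^+ 2 * ((u - v) * (1 - u - v)) by ring.
by rewrite mulr_ge0 ?sqr_ge0 // mulr_ge0; lra.
Qed.

(** After cancelling [1 + e] this reads 1/p <= 1 - 1/n, and both reciprocals are at most 1/2. *)
Lemma spread_diag_ge (n p : nat) : (2 <= n <= p)%N -> 1 + e <= spread e n p.
Proof.
move=> /andP[n2 np]; have n0 : (0 < n)%N by apply: leq_trans n2.
have p0 := leq_trans n0 np.
rewrite !spread_inv //.
have uu : p%:R^-1 <= n%:R^-1 :> R by rewrite lef_pV2 ?ler_nat ?posrE ?ltr0n.
have u2 : n%:R^-1 <= 2^-1 :> R by rewrite lef_pV2 ?ler_nat ?posrE ?ltr0n.
have /andP[v0 _] := invn_le1 p0.
move: n%:R^-1 p%:R^-1 uu u2 v0 => u v uu u2 v0.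
have ve : 0 < v * e by rewrite mulr_gt0.
rewrite ler_pdivlMr; last lra.
rewrite mulrC ler_pM2r; last by rewrite addr_gt0.
rewrite lerD2l ler_pM2r //; lra.
Qed.

End Spread.

(** * Symmetry sets and their ordered sizes *)

Section SymmetrySets.
Context {R : realType} {V D : finType} {rng : V -> {set D}}.
Context {phi : factor R rng} {C : {set V}}.
Implicit Types x y : {ffun 'I_(arity phi) -> D}.

Lemma permute_permute n (x : {ffun 'I_n -> D}) (s t : 'S_n) :
  permute (permute x s) t = permute x (t * s)%g.
Proof. by apply/ffunP => i; rewrite !ffunE permM. Qed.

Lemma perms_onP (s : 'S_(arity phi)) :
  reflect (forall i, arg i \notin C -> s i = i) (s \in perms_on phi C).
Proof.
rewrite inE; apply: (iffP forallP) => sC i; first by move/(implyP (sC i))/eqP.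
by apply/implyP => /sC ->.
Qed.

Lemma perms_onM s t : s \in perms_on phi C -> t \in perms_on phi C ->
  (s * t)%g \in perms_on phi C.
Proof.
move=> /perms_onP sC /perms_onP tC; apply/perms_onP => i iC.
by rewrite permM sC ?tC.
Qed.

Lemma perms_onV s : s \in perms_on phi C -> (s^-1)%g \in perms_on phi C.
Proof.
by move=> /perms_onP sC; apply/perms_onP => i iC; rewrite -{1}(sC i) // permK.
Qed.

Lemma symset_sub x y : y \in symset C x -> symset C y \subset symset C x.
Proof.
move=> /imsetP[s sC ->]; apply/subsetP => _ /imsetP[t tC ->].
by rewrite permute_permute imset_f // perms_onM.
Qed.

Lemma symset_sym x y : y \in symset C x -> x \in symset C y.
Proof.
move=> /imsetP[s sC ->]; apply/imsetP; exists (s^-1)%g; first exact: perms_onV.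
by rewrite permute_permute mulVg; apply/ffunP => i; rewrite ffunE perm1.
Qed.

Lemma symset_eq {x y} : y \in symset C x -> symset C y = symset C x.
Proof. by move=> yx; apply/eqP; rewrite eqEsubset !symset_sub // symset_sym. Qed.

Lemma card_symset_gt0 x : (0 < #|symset C x|)%N.
Proof. by rewrite card_gt0; apply/set0Pn; exists x; exact: symset_refl. Qed.

Section Representatives.
Context {xs : seq {ffun 'I_(arity phi) -> D}}.

Lemma class_size_gt0 j : (0 < class_size C xs j)%N.
Proof.
rewrite /class_size.
(* Past the end of the list the default size 1 is still positive. *)
have [jn|nj] := ltnP j.-1 (size xs); last by rewrite nth_default ?size_map.
case: xs jn => // x0 xs' jn.
by rewrite (nth_map x0) // card_symset_gt0.
Qed.

Hypothesis hxs : ordered_representatives C xs.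

Lemma symset_rep x : x \in fdom phi ->
  exists2 p, (p < size xs)%N & symset C x = symset C (nth x xs p).
Proof.
have [_ _ <- _] := hxs.
rewrite bigcup_seq => /bigcupP[y yxs xy].
by exists (index y xs); rewrite ?index_mem // nth_index //; apply: symset_eq.
Qed.

Lemma class_size_anti i j : (i <= j)%N ->
  (class_size C xs j <= class_size C xs i)%N.
Proof.
move=> ij; have [jn|nj] := ltnP j.-1 (size xs); last first.
  by rewrite {1}/class_size nth_default ?size_map // class_size_gt0.
have [_ _ _ xs_sorted] := hxs.
have ij' : (i.-1 <= j.-1)%N by rewrite -!subn1 leq_sub2r.
apply: (sorted_leq_nth _ _ 1%N xs_sorted) => //.
- by move=> a b c /= ba ac; apply: leq_trans ac ba.
- by move=> a /=.
- by rewrite inE size_map (leq_ltn_trans ij').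
- by rewrite inE size_map.
Qed.

Lemma card_symset_rep x0 p : (p < size xs)%N ->
  #|symset C (nth x0 xs p)| = class_size C xs p.+1.
Proof. by move=> pn; rewrite /class_size (nth_map x0). Qed.

Lemma card_symset_le x : x \in fdom phi ->
  (#|symset C x| <= class_size C xs 1)%N.
Proof.
by move=> /symset_rep[p pn ->]; rewrite card_symset_rep // class_size_anti.
Qed.

(** Two distinct sets cannot both come first in the list, so one has position at least 2. *)
Lemma card_symset_neq x y : x \in fdom phi -> y \in fdom phi ->
  symset C x != symset C y ->
  (#|symset C x| <= class_size C xs 2)%N ||
  (#|symset C y| <= class_size C xs 2)%N.
Proof.
move=> /symset_rep[p pn ->] /symset_rep[q qn ->].
(* With a common default, positions [p = q = 0] give the same set, contradicting distinctness. *)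
rewrite (set_nth_default x y qn).
case: p pn => [|p] pn; last by rewrite card_symset_rep // class_size_anti.
case: q qn => [|q] qn; first by rewrite eqxx.
by rewrite orbC card_symset_rep // class_size_anti.
Qed.

End Representatives.
End SymmetrySets.

(** * Comparison of a factor with its mean *)

Section Mean.
Context {R : realType} {V D : finType} {rng : V -> {set D}}.
Context {phi : factor R rng} {C : {set V}} {e : R}.
Implicit Types x y : {ffun 'I_(arity phi) -> D}.
Hypothesis e_gt0 : 0 < e.
Hypothesis phiC : eps_commutative e phi C.

Lemma eps_commutative_le x y : x \in fdom phi -> y \in symset C x ->
  phi x <= (1 + e) * phi y /\ phi y <= (1 + e) * phi x.
Proof.
have [_ _ _ h] := phiC => xD /imsetP[s sC ->].
have [/andP[_ ?] /andP[_ ?]] := h x s xD sC.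
by rewrite ![(1 + e) * _]mulrC.
Qed.

Lemma mean_pot_symset {x y} : y \in symset C x -> mean_pot C y = mean_pot C x.
Proof. by move=> yx; rewrite /mean_pot (symset_eq yx). Qed.

Lemma pot_mean_ge0 x y : 0 <= phi x * mean_pot C y.
Proof. by rewrite mulr_ge0 ?pot_ge0 // mean_pot_ge0. Qed.

Lemma mean_potE x (n := #|symset C x|%:R : R) :
  n * mean_pot C x = phi x + \sum_(y in symset C x | y != x) phi y.
Proof.
rewrite /mean_pot mulVKf ?pnatr_eq0 -?lt0n ?card_symset_gt0 //.
by rewrite (bigD1 x) ?symset_refl.
Qed.

Lemma sum_symset_const x (c : R) :
  \sum_(y in symset C x | y != x) c = (#|symset C x|%:R - 1) * c.
Proof.
have h : \sum_(y in symset C x) c = c + \sum_(y in symset C x | y != x) c.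
  by rewrite (bigD1 x) ?symset_refl.
by rewrite mulrBl mul1r mulr_natl -sumr_const h addrAC subrr add0r.
Qed.

(** Only the [n - 1] other elements can exceed [phi x], each by a factor of at most [1 + e]. *)
Lemma mean_pot_le x (n := #|symset C x|%:R : R) : x \in fdom phi ->
  mean_pot C x <= (1 + (n - 1) / n * e) * phi x.
Proof.
move=> xD; have n0 : 0 < n by rewrite ltr0n card_symset_gt0.
rewrite -(ler_pM2l n0) [n * mean_pot _ _]mean_potE.
have -> : n * ((1 + (n - 1) / n * e) * phi x) =
    phi x + (n - 1) * ((1 + e) * phi x).
  by field; rewrite gt_eqF.
rewrite lerD2l -sum_symset_const.
by apply: ler_sum => y /andP[yx _]; have [] := eps_commutative_le _ _ xD yx.
Qed.

(** The other values are bounded below by [phi x / (1 + e)], which is sharper than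
    [(1 - e) * phi x]. *)
Lemma mean_pot_ge x (n := #|symset C x|%:R : R) : x \in fdom phi ->
  (1 + 1 / n * e) * phi x <= (1 + e) * mean_pot C x.
Proof.
move=> xD; have n0 : 0 < n by rewrite ltr0n card_symset_gt0.
rewrite -(ler_pM2l n0) [leRHS]mulrCA [n * mean_pot _ _]mean_potE mulrDr mulr_sumr.
have -> : n * ((1 + 1 / n * e) * phi x) =
    (1 + e) * phi x + (n - 1) * phi x.
  by field; rewrite gt_eqF.
rewrite lerD2l -sum_symset_const.
by apply: ler_sum => y /andP[yx _]; have [] := eps_commutative_le _ _ xD yx.
Qed.

(** Product of the upper bound at [x] and the lower bound at [y], cross-multiplied because [phi] may
    vanish. *)
Lemma mean_pot_cross x y : x \in fdom phi -> y \in fdom phi ->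
  mean_pot C x * phi y <=
    spread e #|symset C x| #|symset C y| * (phi x * mean_pot C y).
Proof.
move=> xD yD; have ux := mean_pot_le _ xD; have ly := mean_pot_ge _ yD.
have d0 : 0 < 1 + 1 / #|symset C y|%:R * e.
  by rewrite ltr_pwDl // mulr_ge0 ?divr_ge0 ?ler0n // ltW.
rewrite /spread [leRHS]mulrAC ler_pdivlMr // -[leLHS]mulrA [phi y * _]mulrC.
rewrite [leRHS](_ : _ = (1 + (#|symset C x|%:R - 1) / #|symset C x|%:R * e) *
  phi x * ((1 + e) * mean_pot C y)); last by ring.
apply: ler_pM => //; first exact: mean_pot_ge0.
by rewrite mulr_ge0 ?pot_ge0 // ltW.
Qed.

Lemma mean_pot_cross_same x y : x \in fdom phi -> y \in symset C x ->
  mean_pot C x * phi y <= (1 + e) * (phi x * mean_pot C y).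
Proof.
move=> xD yx; rewrite (mean_pot_symset yx) mulrC mulrA.
by rewrite ler_wpM2r ?mean_pot_ge0 //; have [] := eps_commutative_le _ _ xD yx.
Qed.

Context {xs : seq {ffun 'I_(arity phi) -> D}}.
Hypothesis hxs : ordered_representatives C xs.
Let m1 := class_size C xs 1.
Let m2 := class_size C xs 2.

(** Cruder than the sharp bound, but free of conditions on [m2]; it yields the strict bound on the
    distance. *)
Lemma mean_pot_cross_uniform x y : x \in fdom phi -> y \in fdom phi ->
  mean_pot C x * phi y <= spread e m1 m1 * (phi x * mean_pot C y).
Proof.
move=> xD yD; apply: le_trans (mean_pot_cross _ _ xD yD) _.
rewrite ler_wpM2r ?pot_mean_ge0 //.
by apply: (spread_mono e_gt0); rewrite card_symset_gt0 card_symset_le.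
Qed.

(** If [m2 = 1 < m1], then [spread e m2 m1] is below [1 + e], a ratio that can occur inside one
    symmetry set; hence the side condition. *)
Lemma mean_pot_cross_sharp x y : m1 = 1%N \/ (2 <= m2)%N ->
  x \in fdom phi -> y \in fdom phi ->
  mean_pot C x * phi y <= spread e m2 m1 * (phi x * mean_pot C y).
Proof.
move=> m12 xD yD.
have m21 : (m2 <= m1)%N by apply: class_size_anti.
case: m12 => [m1E|m2_ge2].
  have -> : m2 = m1.
    by apply/eqP; rewrite eqn_leq m21 m1E class_size_gt0.
  exact: mean_pot_cross_uniform.
have [yx|xy] := boolP (y \in symset C x).
  apply: le_trans (mean_pot_cross_same _ _ xD yx) _.
  rewrite ler_wpM2r ?pot_mean_ge0 //.
  by apply: (spread_diag_ge e_gt0); rewrite m2_ge2.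
apply: le_trans (mean_pot_cross _ _ xD yD) _.
rewrite ler_wpM2r ?pot_mean_ge0 //.
have neq : symset C x != symset C y.
  by apply: contraNneq xy => ->; apply: symset_refl.
have xm1 := card_symset_le hxs _ xD; have ym1 := card_symset_le hxs _ yD.
have /orP[xm2|ym2] := card_symset_neq hxs _ _ xD yD neq.
  by apply: (spread_mono e_gt0); rewrite card_symset_gt0.
(* Here the small set is that of [y], so monotonicity gives the sizes in the opposite order. *)
apply: (@le_trans _ _ (spread e m1 m2)); last first.
  by apply: (spread_swap e_gt0); rewrite m2_ge2.
by apply: (spread_mono e_gt0); rewrite card_symset_gt0.
Qed.

End Mean.

(** * From cross-multiplied inequalities to the distance *)

Lemma D_CD_le {R : realType} {V D : finType} {rng : V -> {set D}}
    (P P' : {ffun V -> D} -> R) (B : R) :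
  (exists2 r, r \in assignments rng & 0 < P r) ->
  {in assignments rng, forall r, 0 < P r -> 0 < P' r} ->
  {in assignments rng &, forall r s, P' r * P s <= B * (P r * P' s)} ->
  D_CD rng P P' <= ln B.
Proof.
move=> [r0 r0A Pr0] PP' cross.
have P'r0 := PP' _ r0A Pr0.
have B_ge1 : 1 <= B.
  have := cross r0 r0 r0A r0A.
  by rewrite [P r0 * _]mulrC -{1}[P' r0 * _]mul1r ler_pM2r // mulr_gt0.
have B_gt0 : 0 < B by apply: lt_le_trans B_ge1.
have max_gt0 : 0 < max_quotient rng P P'.
  apply: (@lt_le_trans _ _ (P' r0 / P r0)); first by rewrite divr_gt0.
  by apply: (le_bigmax_cond _ (fun r => P' r / P r)); rewrite r0A.
(* By [cross], each quotient is at most [B] times any other. *)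
have max_le_min : max_quotient rng P P' / B <= min_quotient rng P P'.
  apply: le_bigmin => [|s /andP[sA Ps]].
    (* The minimum has the maximum as its neutral element; this is where [B_ge1] enters. *)
    by rewrite ler_pdivrMr // ler_peMr // ltW.
  have P's := PP' _ sA Ps.
  rewrite ler_pdivrMr // mulrC.
  apply: bigmax_le => [|r /andP[rA Pr]].
    by rewrite mulr_ge0 ?divr_ge0 // ltW.
  rewrite ler_pdivrMr // mulrA mulrAC ler_pdivlMr //.
  by apply: le_trans (cross r s rA sA) _; rewrite [P r * _]mulrC mulrA.
have min_gt0 : 0 < min_quotient rng P P'.
  by apply: lt_le_trans max_le_min; rewrite divr_gt0.
rewrite /D_CD lerBlDr -lnM ?posrE // ler_ln ?posrE ?mulr_gt0 // mulrC.
by rewrite -ler_pdivrMr.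
Qed.

(** * Symmetrised factor graphs *)

Section Graphs.
Context {R : realType} {V D : finType} {rng : V -> {set D}} {m k : nat}.
Context {M : 'I_m -> factor R rng} {C : 'I_m -> {set V}}.
Let M' := symmetrise k C M.
Hypothesis hZ : 0 < partition_function M.

Lemma proj_fdom (phi : factor R rng) r :
  r \in assignments rng -> proj phi r \in fdom phi.
Proof.
by rewrite !inE => /forallP rA; apply/forallP => i; rewrite ffunE.
Qed.

Lemma psi_ge0 (N : 'I_m -> factor R rng) r : 0 <= psi N r.
Proof. by apply: prodr_ge0 => j _; apply: pot_ge0. Qed.

Lemma symmetriseE j r : M' j (proj (M' j) r) =
  if (j < k)%N then mean_pot (C j) (proj (M j) r) else M j (proj (M j) r).
Proof. by rewrite /M' /symmetrise; case: ifP. Qed.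

(** A symmetry set contains the point itself, so averaging nonnegative values keeps positivity
    there. *)
Lemma psi_symmetrise_gt0 r : 0 < psi M r -> 0 < psi M' r.
Proof.
move=> psi_gt0; apply: prodr_gt0 => j _.
have phi_gt0 : 0 < M j (proj (M j) r).
  rewrite lt0r pot_ge0 andbT.
  by move: psi_gt0; rewrite lt0r => /andP[/prodf_neq0 /(_ j isT)].
rewrite symmetriseE; case: ifP => // _.
rewrite /mean_pot mulr_gt0 ?invr_gt0 ?ltr0n ?card_symset_gt0 //.
rewrite (bigD1 (proj (M j) r)) ?symset_refl //= ltr_pwDl // sumr_ge0 // => y _.
exact: pot_ge0.
Qed.

Lemma exists_psi_gt0 : exists2 r, r \in assignments rng & 0 < psi M r.
Proof.
have := lt0r_neq0 hZ; rewrite psumr_neq0 => [|r _]; last exact: psi_ge0.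
by case/hasP => r _ /andP[]; exists r.
Qed.

Lemma D_CD_symmetrise_le (B : 'I_m -> R) :
  (forall j : 'I_m, (j < k)%N -> {in fdom (M j) &, forall x y,
     mean_pot (C j) x * M j y <= B j * (M j x * mean_pot (C j) y)}) ->
  D_CD rng (distr M) (distr M') <= ln (\prod_(j < m | (j < k)%N) B j).
Proof.
move=> cross; have [r0 r0A psi_r0] := exists_psi_gt0.
have Z'_gt0 : 0 < partition_function M'.
  rewrite /partition_function (bigD1 r0) //= ltr_pwDl ?psi_symmetrise_gt0 //.
  by rewrite sumr_ge0 // => r _; apply: psi_ge0.
have distr_gt0 r : (0 < distr M r) = (0 < psi M r).
  by rewrite /distr pmulr_lgt0 ?invr_gt0.
apply: D_CD_le; first by exists r0; rewrite ?distr_gt0.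
  by move=> r _; rewrite distr_gt0 => psi_r; rewrite divr_gt0 ?psi_symmetrise_gt0.
(* Both sides carry the same normalisation 1/(Z Z'), which is split off. *)
move=> r s rA sA; rewrite /distr mulrACA [X in _ <= _ * X]mulrACA [leRHS]mulrA.
rewrite [_^-1 * _^-1]mulrC.
rewrite ler_wpM2r ?mulr_ge0 ?invr_ge0 ?(ltW hZ) ?(ltW Z'_gt0) //.
(* Unchanged factors get the multiplier 1, so the products compare factor by factor. *)
rewrite /psi [X in _ <= X * _]big_mkcond -!big_split /=.
apply: ler_prod => j _ /=.
rewrite !symmetriseE mulr_ge0 ?pot_ge0 //=; last by case: ifP; rewrite ?mean_pot_ge0 ?pot_ge0.
case: ifP => [jk|_]; last by rewrite mul1r.
by apply: cross; rewrite ?proj_fdom.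
Qed.

End Graphs.

(** The condition on [m1] and [m2] excludes cases such as two Boolean arguments, with class sizes 2,
    1, 1: values 1 and [1 + eps] on the large class, 1 elsewhere, give distance [ln (1 + eps)],
    above [bound]. For [k = 0] both logarithms in the strict inequality are 0. *)
Theorem theorem4 (R : realType) (V D : finType) (rng : V -> {set D})
    (m k : nat) (M : 'I_m -> factor R rng) (C : 'I_m -> {set V}) (eps : R)
    (reps : forall i : 'I_m, seq {ffun 'I_(arity (M i)) -> D})
    (hkm : (k <= m)%N)
    (heps : 0 < eps <= 1)
    (hZ : 0 < partition_function M)
    (hcomm : forall i : 'I_m, (i < k)%N -> eps_commutative eps (M i) (C i))
    (hreps : forall i : 'I_m, (i < k)%N ->
       ordered_representatives (C i) (reps i)) :
  let M' := symmetrise k C M in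
  let m1 (i : 'I_m) := class_size (C i) (reps i) 1%N in
  let m2 (i : 'I_m) := class_size (C i) (reps i) 2%N in
  let dist := D_CD rng (distr M) (distr M') in
  let bound := ln (\prod_(i < m | (i < k)%N)
        ((1 + ((m2 i)%:R - 1) / (m2 i)%:R * eps) * (1 + eps)
         / (1 + 1 / (m1 i)%:R * eps))) in
  ((forall i : 'I_m, (i < k)%N -> m1 i = 1%N \/ (2 <= m2 i)%N) ->
    dist <= bound) /\
  ((0 < k)%N ->
    bound < ln ((1 + eps) ^+ (2 * k)) /\ dist < ln ((1 + eps) ^+ (2 * k))).
Proof.
have /andP[eps_gt0 _] := heps => M' m1 m2 dist bound.
have m1_gt0 i : (0 < m1 i)%N by apply: class_size_gt0.
have m2_gt0 i : (0 < m2 i)%N by apply: class_size_gt0.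
have prod_spread_gt0 (n p : 'I_m -> nat) :
    (forall i, 0 < n i)%N -> (forall i, 0 < p i)%N ->
    0 < \prod_(i < m | (i < k)%N) spread eps (n i) (p i).
  by move=> n_gt0 p_gt0; apply: prodr_gt0 => i _; apply: spread_gt0.
have ln_spread_lt (n p : 'I_m -> nat) : (0 < k)%N ->
    (forall i, 0 < n i)%N -> (forall i, 0 < p i)%N ->
    ln (\prod_(i < m | (i < k)%N) spread eps (n i) (p i)) <
    ln ((1 + eps) ^+ (2 * k)).
  move=> k_gt0 n_gt0 p_gt0.
  rewrite ltr_ln ?posrE ?prod_spread_gt0 ?exprn_gt0 ?addr_gt0 //.
  have -> : (1 + eps) ^+ (2 * k) =
      \prod_(i < m | (i < k)%N) (1 + eps) ^+ 2.
    by rewrite -(big_ord_widen m (fun=> (1 + eps) ^+ 2) hkm) prodr_const card_ord exprM.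
  apply: ltr_prod => [|i _]; last by rewrite ltW ?spread_gt0 ?spread_lt.
  (* Strictness of the product needs a nonempty index range; index 0 is a witness. *)
  by apply/hasP; exists (Ordinal (leq_trans k_gt0 hkm)); rewrite ?mem_index_enum.
split=> [m12|k_gt0].
  apply: D_CD_symmetrise_le => // j jk x y xD yD.
  by apply: (mean_pot_cross_sharp eps_gt0 (hcomm j jk) (hreps j jk)) => //; apply: m12.
split; first exact: ln_spread_lt.
(* Without the side condition [bound] may lie below [dist], so the product with [m1] in both places
   mediates. *)
apply: le_lt_trans (ln_spread_lt m1 m1 k_gt0 m1_gt0 m1_gt0).
apply: D_CD_symmetrise_le => // j jk x y xD yD.
exact: (mean_pot_cross_uniform eps_gt0 (hcomm j jk) (hreps j jk)).
Qed.
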